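(* Let $n\ge1$. The assignments $$Z(s_i)=s_i,\qquad Z(\sigma_i)=\exp(a_{i,i+1})\,s_i,\qquad Z(\sigma_i^{-1})=s_i\exp(-a_{i,i+1})\qquad(1\le i\le n-1)$$ respect all the defining relations of the w-braid group $wB_n$, and hence define a multiplicative map $Z\colon wB_n\to\mathcal{A}^w_n$. This $Z$ is a homomorphic expansion: $Z(B_1B_2)=Z(B_1)Z(B_2)$ for all $B_1,B_2\in wB_n$, and for every $m\ge0$ and every $m$-singular w-braid $B$ with underlying arrow diagram $D$ one has $Z(B)=D+(\text{terms of degree}>m)$.
   Context: **w-braids.** $wB_n$ is the group generated by $\sigma_i,s_i$ ($1\le i\le n-1$) subject to: - $s_i^2=1$, $s_is_{i+1}s_i=s_{i+1}s_is_{i+1}$, and $s_is_j=s_js_i$ for $|i-j|>1$; - $\sigma_i\sigma_{i+1}\sigma_i=\sigma_{i+1}\sigma_i\sigma_{i+1}$, and $\sigma_i\sigma_j=\sigma_j\sigma_i$ for $|i-j|>1$; - $s_i\sigma_{i+1}^{\pm1}s_i=s_{i+1}\sigma_i^{\pm1}s_{i+1}$, and $s_i\sigma_j=\sigma_js_i$ for $|i-j|>1$; - overcrossings commute: $\sigma_i\sigma_{i+1}s_i=s_{i+1}\sigma_i\sigma_{i+1}$. **Arrow diagrams.** $\mathcal{A}^w_n$ is the degree completion of the graded associative unital $\mathbb{Q}$-algebra generated by degree-$1$ elements $a_{ij}$ ($1\le i\ne j\le n$) and the group algebra $\mathbb{Q}S_n$ (degree $0$), subject to: - $a_{ij}a_{kl}=a_{kl}a_{ij}$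 for $i,j,k,l$ distinct; - TC: $[a_{ij},a_{ik}]=0$ for $i,j,k$ distinct; - $\overrightarrow{4T}$: $[a_{ij}+a_{ik},a_{jk}]=0$ for $i,j,k$ distinct; - $a_{ij}\tau=\tau a_{\tau(i)\tau(j)}$ for $\tau\in S_n$, where permutations are multiplied left to right, $(\tau\tau')(i)=\tau'(\tau(i))$, and $s_i\in S_n$ denotes the transposition $(i,i+1)$. **Singular braids.** An $m$-singular w-braid is a word in the letters $\sigma_i^{\pm1}$, $s_i$ and the semi-virtual crossings $\bar\sigma_i^{+}:=\sigma_i-s_i$, $\bar\sigma_i^{-}:=s_i-\sigma_i^{-1}$, with exactly $m$ semi-virtual letters. It is regarded as an element of the group ring $\mathbb{Q}wB_n$, and $Z$ is extended linearly to $\mathbb{Q}wB_n$. Its underlying arrow diagram $D\in\mathcal{A}^w_n$ (homogeneous of degree $m$) is the product obtained from the word by replacing each $\bar\sigma_i^{+}$ by $a_{i,i+1}s_i$, each $\bar\sigma_i^{-}$ by $s_ia_{i,i+1}$, and each $\sigma_i^{\pm1}$ or $s_i$ by $s_i\in S_n$. *)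

(* Defs.v *)
From HB Require Import structures.
From mathcomp Require Import all_boot all_order all_fingroup all_algebra.
From mathcomp Require Import finmap boolp zify.
From mathcomp Require Import monalg generic_quotient ring_quotient.

Set Implicit Arguments.
Unset Strict Implicit.
Unset Printing Implicit Defensive.

Import GRing.Theory Num.Theory.
Import Quotient.
Local Open Scope ring_scope.
Local Open Scope quotient_scope.

(* [(x, true)] stands for the generator [x], [(x, false)] for its formal
   inverse. *)
Definition gword (X : Type) := seq (X * bool).

Section PresentedGroup.
Variables (X : choiceType) (R : gword X -> gword X -> Prop).

Inductive gcong : gword X -> gword X -> Prop :=
| gcong_refl u : gcong u u
| gcong_sym u v : gcong u v -> gcong v u
| gcong_trans u v w : gcong u v -> gcong v w -> gcong u w
| gcong_cat u u' v v' : gcong u u' -> gcong v v' -> gcong (u ++ v) (u' ++ v')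
| gcong_cancel x b : gcong [:: (x, b); (x, ~~ b)] [::]
| gcong_rel u v : R u v -> gcong u v.

Definition gcongb (u v : gword X) : bool := `[< gcong u v >].

Lemma gcongb_equiv : equiv_class_of gcongb.
Proof.
split=> [u|u v|v u w]; first by apply/asboolP/gcong_refl.
  by apply/asboolP/asboolP; apply: gcong_sym.
by move=> /asboolP h1 /asboolP h2; apply/asboolP/(gcong_trans h1 h2).
Qed.

Canonical gcongb_equivRel := EquivRelPack gcongb_equiv.
Canonical gcongb_encModRel := defaultEncModRel gcongb.

Definition presgroup := {eq_quot gcongb}.
HB.instance Definition _ : EqQuotient (gword X) gcongb presgroup :=
  EqQuotient.on presgroup.
HB.instance Definition _ := Choice.on presgroup.

Definition gclass (w : gword X) : presgroup := \pi w.

Lemma gclassP u v : gclass u = gclass v <-> gcong u v.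
Proof.
split=> [/eqP|h]; first by rewrite piE => /asboolP.
by apply/eqP; rewrite piE; apply/asboolP.
Qed.

Definition gword_inv (w : gword X) : gword X :=
  rev [seq (l.1, ~~ l.2) | l <- w].

Definition pg_one : presgroup := gclass [::].
Definition pg_mul (x y : presgroup) : presgroup := gclass (repr x ++ repr y).
Definition pg_inv (x : presgroup) : presgroup := gclass (gword_inv (repr x)).

Lemma gclass_repr x : gclass (repr x) = x. Proof. exact: reprK. Qed.

Lemma gclass_cat u v : gclass (u ++ v) = pg_mul (gclass u) (gclass v).
Proof. by apply/gclassP/gcong_cat; apply/gclassP; rewrite gclass_repr. Qed.

Lemma gword_invK : involutive gword_inv.
Proof.
move=> w; rewrite /gword_inv map_rev revK -map_comp -[RHS]map_id.
by apply: eq_map => -[x b] /=; rewrite negbK.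
Qed.

Lemma gcong_invr w : gcong (w ++ gword_inv w) [::].
Proof.
elim: w => [|[x b] w IH]; first exact: gcong_refl.
apply: gcong_trans (gcong_cancel x b).
have -> : ((x, b) :: w) ++ gword_inv ((x, b) :: w) =
    [:: (x, b)] ++ ((w ++ gword_inv w) ++ [:: (x, ~~ b)]).
  by rewrite /gword_inv /= rev_cons -cats1 catA.
apply: (@gcong_cat _ [:: (x, b)] _ [:: (x, ~~ b)]); first exact: gcong_refl.
exact: (@gcong_cat _ [::] _ [:: (x, ~~ b)] IH (gcong_refl _)).
Qed.

Lemma gcong_invl w : gcong (gword_inv w ++ w) [::].
Proof. by rewrite -{2}[w]gword_invK; apply: gcong_invr. Qed.

Lemma pg_mulA : associative pg_mul.
Proof.
by move=> x y z; rewrite -[x]gclass_repr -[y]gclass_repr -[z]gclass_repr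
  -!gclass_cat catA.
Qed.

Lemma pg_mul1 : left_id pg_one pg_mul.
Proof. by move=> x; rewrite -[x]gclass_repr -gclass_cat. Qed.

Lemma pg_mulr1 : right_id pg_one pg_mul.
Proof. by move=> x; rewrite -[x]gclass_repr -gclass_cat cats0. Qed.

Lemma pg_mulV : left_inverse pg_one pg_inv pg_mul.
Proof.
move=> x; rewrite -[X in pg_mul _ X]gclass_repr -gclass_cat.
exact/gclassP/gcong_invl.
Qed.

Lemma pg_mulrV : right_inverse pg_one pg_inv pg_mul.
Proof.
move=> x; rewrite -[X in pg_mul X _]gclass_repr -gclass_cat.
exact/gclassP/gcong_invr.
Qed.

HB.instance Definition _ :=
  isGroup.Build presgroup pg_mulA pg_mul1 pg_mulr1 pg_mulV pg_mulrV.

Lemma gclassM u v : gclass (u ++ v) = (gclass u * gclass v)%g.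
Proof. exact: gclass_cat. Qed.

Lemma gclass1 : gclass [::] = 1%g. Proof. by []. Qed.

End PresentedGroup.

Lemma malg_ind (K : choiceType) (R : nzRingType) (P : {malg R[K]} -> Prop) :
  P 0 -> (forall p q, P p -> P q -> P (p + q)) ->
  (forall a k, P << a *g k >>) -> forall p, P p.
Proof.
by move=> P0 PD PU p; rewrite [p]monalgE; apply: (big_ind P) => // k _; apply: PU.
Qed.

Lemma malg_scalerAr (K : monomType) (R : comNzRingType) (a : R)
    (p q : {malg R[K]}) :
  a *: (p * q) = p * (a *: q).
Proof.
have scaleU (b : R) (w : K) : a *: << b *g w >> = << a * b *g w >>.
  by apply/malgP => k; rewrite mcoeffZ !mcoeffU mulrnAr.
elim/malg_ind: p => [|p1 p2 h1 h2|b w]; first by rewrite !mul0r scaler0.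
  by rewrite !mulrDl scalerDr h1 h2.
elim/malg_ind: q => [|q1 q2 h1 h2|c w']; first by rewrite scaler0 !mulr0 scaler0.
  by rewrite mulrDr !scalerDr mulrDr h1 h2.
rewrite scaleU -[_ * _]/(fgmul _ _) -[RHS]/(fgmul _ _) !fgmulUU scaleU.
by rewrite !mulrA (mulrC a).
Qed.

(* [{malg K[M]}] is a ring in the library only for monoids without nontrivial
   units, so the convolution product is set up here on an alias. *)
Definition groupalg (G : groupType) := {malg rat[G]}.

Section GroupAlgebra.
Variable G : groupType.
Implicit Types p q r : groupalg G.

HB.instance Definition _ := GRing.Lmodule.on (groupalg G).

Definition ga_one : groupalg G := << 1%g >>.
Definition ga_mul p q : groupalg G :=
  \sum_(g <- msupp p) \sum_(h <- msupp q) << p@_g * q@_h *g (g * h)%g >>.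

Lemma ga_mulw (d1 d2 : {fset G}) p q :
  (msupp p `<=` d1)%fset -> (msupp q `<=` d2)%fset ->
  ga_mul p q = \sum_(g <- d1) \sum_(h <- d2) << p@_g * q@_h *g (g * h)%g >>.
Proof.
move=> le1 le2; rewrite /ga_mul (big_fset_incl _ le1) /=; last first.
  by move=> g _ /mcoeff_outdom pg; rewrite big1 // => h _; rewrite pg mul0r monalgU0.
apply/eq_bigr=> g _; apply/big_fset_incl => // h _ /mcoeff_outdom ->.
by rewrite mulr0 monalgU0.
Qed.

Lemma ga_mulUU a b g h :
  ga_mul << a *g g >> << b *g h >> = << a * b *g (g * h)%g >>.
Proof. by rewrite (ga_mulw msuppU_le msuppU_le) !big_seq_fset1 !mcoeffUU. Qed.

Lemma ga_mulDl : left_distributive ga_mul +%R.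
Proof.
move=> p q r; set d := (msupp p `|` msupp q)%fset.
rewrite (@ga_mulw d (msupp r)) ?msuppD_le ?fsubset_refl //.
rewrite (@ga_mulw d (msupp r) p) ?fsubsetUl ?fsubset_refl //.
rewrite (@ga_mulw d (msupp r) q) ?fsubsetUr ?fsubset_refl //.
rewrite -big_split; apply/eq_bigr => g _; rewrite -big_split /=.
by apply/eq_bigr => h _; rewrite mcoeffD mulrDl monalgUD.
Qed.

Lemma ga_mulDr : right_distributive ga_mul +%R.
Proof.
move=> r p q; set d := (msupp p `|` msupp q)%fset.
rewrite (@ga_mulw (msupp r) d) ?msuppD_le ?fsubset_refl //.
rewrite (@ga_mulw (msupp r) d _ p) ?fsubsetUl ?fsubset_refl //.
rewrite (@ga_mulw (msupp r) d _ q) ?fsubsetUr ?fsubset_refl //.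
rewrite -big_split; apply/eq_bigr => g _; rewrite -big_split /=.
by apply/eq_bigr => h _; rewrite mcoeffD mulrDr monalgUD.
Qed.

Lemma ga_mul0r : left_zero 0 ga_mul.
Proof. by move=> p; apply: (addIr (ga_mul 0 p)); rewrite -ga_mulDl !add0r. Qed.

Lemma ga_mulr0 : right_zero 0 ga_mul.
Proof. by move=> p; apply: (addIr (ga_mul p 0)); rewrite -ga_mulDr !add0r. Qed.

Lemma ga_mulA : associative ga_mul.
Proof.
move=> p q r; elim/malg_ind: p => [|p1 p2 h1 h2|a g].
- by rewrite !ga_mul0r.
- by rewrite !ga_mulDl h1 h2.
elim/malg_ind: q => [|q1 q2 h1 h2|b h].
- by rewrite !(ga_mul0r, ga_mulr0).
- by rewrite !(ga_mulDl, ga_mulDr) h1 h2.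
elim/malg_ind: r => [|r1 r2 h1 h2|c k].
- by rewrite !ga_mulr0.
- by rewrite !ga_mulDr h1 h2.
by rewrite !ga_mulUU mulrA mulgA.
Qed.

Lemma ga_mul1 : left_id ga_one ga_mul.
Proof.
move=> p; elim/malg_ind: p => [|p q h1 h2|a g]; first exact: ga_mulr0.
  by rewrite ga_mulDr h1 h2.
by rewrite ga_mulUU mul1r mul1g.
Qed.

Lemma ga_mulr1 : right_id ga_one ga_mul.
Proof.
move=> p; elim/malg_ind: p => [|p q h1 h2|a g]; first exact: ga_mul0r.
  by rewrite ga_mulDl h1 h2.
by rewrite ga_mulUU mulr1 mulg1.
Qed.

Lemma ga_one_neq0 : ga_one != 0.
Proof.
by apply/eqP => /(congr1 (mcoeff 1%g)) /eqP; rewrite mcoeffUU mcoeff0 oner_eq0.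
Qed.

HB.instance Definition _ := GRing.Zmodule_isNzRing.Build (groupalg G)
  ga_mulA ga_mul1 ga_mulr1 ga_mulDl ga_mulDr ga_one_neq0.

Lemma ga_scaleAl (a : rat) p q : a *: (p * q) = (a *: p) * q.
Proof.
have scaleU (b : rat) (g : G) : a *: << b *g g >> = << a * b *g g >> :> groupalg G.
  by apply/malgP => k; rewrite mcoeffZ !mcoeffU mulrnAr.
elim/malg_ind: p => [|p1 p2 h1 h2|b g]; first by rewrite scaler0 !mul0r scaler0.
  by rewrite mulrDl !scalerDr mulrDl h1 h2.
elim/malg_ind: q => [|q1 q2 h1 h2|c h]; first by rewrite !mulr0 scaler0.
  by rewrite !mulrDr scalerDr h1 h2.
rewrite scaleU.
by rewrite -[_ * _]/(ga_mul _ _) -[RHS]/(ga_mul _ _) !ga_mulUU scaleU mulrA.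
Qed.

HB.instance Definition _ :=
  GRing.Lmodule_isLalgebra.Build rat (groupalg G) ga_scaleAl.

Lemma ga_scaleAr (a : rat) p q : a *: (p * q) = p * (a *: q).
Proof.
have scaleU (b : rat) (g : G) : a *: << b *g g >> = << a * b *g g >> :> groupalg G.
  by apply/malgP => k; rewrite mcoeffZ !mcoeffU mulrnAr.
elim/malg_ind: p => [|p1 p2 h1 h2|b g]; first by rewrite !mul0r scaler0.
  by rewrite !mulrDl scalerDr h1 h2.
elim/malg_ind: q => [|q1 q2 h1 h2|c h]; first by rewrite scaler0 !mulr0 scaler0.
  by rewrite mulrDr !scalerDr mulrDr h1 h2.
rewrite scaleU.
rewrite -[_ * _]/(ga_mul _ _) -[RHS]/(ga_mul _ _) !ga_mulUU scaleU.
by rewrite !mulrA (mulrC a).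
Qed.

HB.instance Definition _ :=
  GRing.Lalgebra_isAlgebra.Build rat (groupalg G) ga_scaleAr.

Definition ga_of (g : G) : groupalg G := << g >>.

Lemma ga_of1 : ga_of 1%g = 1. Proof. by []. Qed.

Lemma ga_ofM g h : ga_of (g * h)%g = ga_of g * ga_of h.
Proof. by rewrite -[RHS]/(ga_mul _ _) ga_mulUU mulr1. Qed.

Definition linext (V : lmodType rat) (f : G -> V) (p : groupalg G) : V :=
  \sum_(g <- msupp p) p@_g *: f g.

End GroupAlgebra.

Notation freealg X := {malg rat[{fmonom X}]}.

(* Locked so that unification does not compare generators by evaluation. *)
HB.lock Definition fgen (X : choiceType) (x : X) : freealg X := << fmu x >>.

Lemma fgenE (X : choiceType) (x : X) : fgen x = << fmu x >>.
Proof. by rewrite fgen.unlock. Qed.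

Section PresentedAlgebra.
Variables (X : choiceType) (R : freealg X -> freealg X -> Prop).
Local Notation F := (freealg X).
Implicit Types p q u v : F.

Inductive ideal_gen : F -> Prop :=
| ideal_gen0 : ideal_gen 0
| ideal_genD p q : ideal_gen p -> ideal_gen q -> ideal_gen (p + q)
| ideal_gen_rel p u v q : R u v -> ideal_gen (p * (u - v) * q).

Definition ideal_pred : F -> bool := fun p => `[< ideal_gen p >].

Lemma ideal_genM p q r : ideal_gen q -> ideal_gen (p * q * r).
Proof.
elim=> [|q1 q2 _ h1 _ h2|p' u v q' h]; first by rewrite mulr0 mul0r; exact: ideal_gen0.
  by rewrite mulrDr mulrDl; exact: ideal_genD.
by rewrite !mulrA -mulrA; apply: ideal_gen_rel.
Qed.

Lemma ideal_pred_zmod_closed : zmod_closed ideal_pred.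
Proof.
split=> [|p q /asboolP hp /asboolP hq]; apply/asboolP; first exact: ideal_gen0.
apply: ideal_genD => //; have := @ideal_genM (- 1) q 1 hq.
by rewrite mulN1r mulr1.
Qed.

HB.instance Definition _ :=
  GRing.isZmodClosed.Build F ideal_pred ideal_pred_zmod_closed.

Definition ideal : zmodClosed F := GRing.ZmodClosed.clone F ideal_pred _.

Definition presalg := {quot ideal}.
HB.instance Definition _ := GRing.Zmodule.on presalg.

Definition pa_class (p : F) : presalg := \pi p.
Definition pa_repr (x : presalg) : F := repr x.

Lemma pa_reprK x : pa_class (pa_repr x) = x. Proof. exact: reprK. Qed.

Lemma pa_classP p q : pa_class p = pa_class q <-> ideal_gen (p - q).
Proof.
have e : (p - q \in ideal) = (pa_class p == pa_class q).
  exact: Quotient.idealrBE.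
split=> [/eqP|h]; first by rewrite -e => /asboolP.
by apply/eqP; rewrite -e; apply/asboolP.
Qed.

Lemma pa_class_is_zmod_morphism : zmod_morphism pa_class.
Proof. by move=> p q; rewrite /pa_class !piE. Qed.
HB.instance Definition _ :=
  GRing.isZmodMorphism.Build F presalg pa_class pa_class_is_zmod_morphism.

Definition pa_one : presalg := pa_class 1.
Definition pa_mul (x y : presalg) : presalg := pa_class (pa_repr x * pa_repr y).
Definition pa_scale (a : rat) (x : presalg) : presalg := pa_class (a *: pa_repr x).

Lemma pa_class_mul p q : pa_class (p * q) = pa_mul (pa_class p) (pa_class q).
Proof.
apply/pa_classP; set p' := pa_repr _; set q' := pa_repr _.
have hp : ideal_gen (p - p') by apply/pa_classP; rewrite pa_reprK.
have hq : ideal_gen (q - q') by apply/pa_classP; rewrite pa_reprK.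
have -> : p * q - p' * q' = 1 * (p - p') * q + p' * (q - q') * 1.
  by rewrite mul1r mulr1 mulrBl mulrBr addrA subrK.
by apply: ideal_genD; apply: ideal_genM.
Qed.

Lemma pa_class_scale a p : pa_class (a *: p) = pa_scale a (pa_class p).
Proof.
apply/pa_classP; set p' := pa_repr _.
have hp : ideal_gen (p - p') by apply/pa_classP; rewrite pa_reprK.
rewrite -scalerBr.
have -> : a *: (p - p') = (a *: 1) * (p - p') * 1.
  by rewrite mulr1 -scalerAl mul1r.
exact: ideal_genM.
Qed.

Lemma pa_mulA : associative pa_mul.
Proof.
by move=> x y z; rewrite -[x]pa_reprK -[y]pa_reprK -[z]pa_reprK
  -!pa_class_mul mulrA.
Qed.

Lemma pa_mul1 : left_id pa_one pa_mul.
Proof. by move=> x; rewrite -[x]pa_reprK -pa_class_mul mul1r. Qed.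

Lemma pa_mulr1 : right_id pa_one pa_mul.
Proof. by move=> x; rewrite -[x]pa_reprK -pa_class_mul mulr1. Qed.

Lemma pa_mulDl : left_distributive pa_mul +%R.
Proof.
move=> x y z; rewrite -[x]pa_reprK -[y]pa_reprK -[z]pa_reprK.
by rewrite -raddfD -!pa_class_mul -raddfD mulrDl.
Qed.

Lemma pa_mulDr : right_distributive pa_mul +%R.
Proof.
move=> x y z; rewrite -[x]pa_reprK -[y]pa_reprK -[z]pa_reprK.
by rewrite -raddfD -!pa_class_mul -raddfD mulrDr.
Qed.

HB.instance Definition _ := GRing.Zmodule_isPzRing.Build presalg
  pa_mulA pa_mul1 pa_mulr1 pa_mulDl pa_mulDr.

Lemma pa_scaleA a b x : pa_scale a (pa_scale b x) = pa_scale (a * b) x.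
Proof. by rewrite -[x]pa_reprK -!pa_class_scale scalerA. Qed.

Lemma pa_scale1 : left_id 1 pa_scale.
Proof. by move=> x; rewrite -[x]pa_reprK -pa_class_scale scale1r. Qed.

Lemma pa_scaleDr : right_distributive pa_scale +%R.
Proof.
move=> a x y; rewrite -[x]pa_reprK -[y]pa_reprK -raddfD -!pa_class_scale.
by rewrite -raddfD scalerDr.
Qed.

Lemma pa_scaleDl x : {morph pa_scale^~ x : a b / a + b}.
Proof.
by move=> a b; rewrite -[x]pa_reprK -!pa_class_scale -raddfD scalerDl.
Qed.

HB.instance Definition _ := GRing.Zmodule_isLmodule.Build rat presalg
  pa_scaleA pa_scale1 pa_scaleDr pa_scaleDl.

Lemma pa_classD p q : pa_class (p + q) = pa_class p + pa_class q.
Proof. exact: raddfD. Qed.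
Lemma pa_class0 : pa_class 0 = 0. Proof. exact: raddf0. Qed.
Lemma pa_classM p q : pa_class (p * q) = pa_class p * pa_class q.
Proof. exact: pa_class_mul. Qed.
Lemma pa_class1 : pa_class 1 = 1. Proof. by []. Qed.
Lemma pa_classZ a p : pa_class (a *: p) = a *: pa_class p.
Proof. exact: pa_class_scale. Qed.

Lemma pa_class_rel u v : R u v -> pa_class u = pa_class v.
Proof.
move=> h; apply/pa_classP; rewrite -[u - v]mul1r -[_ * _]mulr1.
exact: ideal_gen_rel.
Qed.

Lemma pa_scalerAl (a : rat) (x y : presalg) : a *: (x * y) = (a *: x) * y.
Proof.
rewrite -[x]pa_reprK -[y]pa_reprK -pa_classM -!pa_classZ -pa_classM.
by rewrite scalerAl.
Qed.

Lemma pa_scalerAr (a : rat) (x y : presalg) : a *: (x * y) = x * (a *: y).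
Proof.
rewrite -[x]pa_reprK -[y]pa_reprK -pa_classM -!pa_classZ -pa_classM.
by rewrite malg_scalerAr.
Qed.

Section Degree.
Variable deg : X -> nat.

Definition wdeg (w : seq X) : nat := (\sum_(x <- w) deg x)%N.

Definition homog_free (m : nat) (p : F) : Prop :=
  forall w, w \in msupp p -> wdeg w = m.

Definition homog (m : nat) (x : presalg) : Prop :=
  exists2 p : F, homog_free m p & x = pa_class p.

Lemma wdegM (w w' : {fmonom X}) : wdeg (mmul w w') = (wdeg w + wdeg w')%N.
Proof. by rewrite fmM /wdeg big_cat. Qed.

Lemma homog_freeU a (w : {fmonom X}) : homog_free (wdeg w) << a *g w >>.
Proof. by move=> w' /(fsubsetP msuppU_le); rewrite in_fset1 => /eqP ->. Qed.

Lemma homog_free0 m : homog_free m 0.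
Proof. by move=> w; rewrite msupp0. Qed.

Lemma homog_freeD m p q :
  homog_free m p -> homog_free m q -> homog_free m (p + q).
Proof.
by move=> hp hq w /(fsubsetP (msuppD_le _ _)); rewrite in_fsetU => /orP[/hp|/hq].
Qed.

Lemma homog_freeN m p : homog_free m p -> homog_free m (- p).
Proof. by move=> hp w; rewrite msuppN => /hp. Qed.

Lemma homog_freeZ m a p : homog_free m p -> homog_free m (a *: p).
Proof. by move=> hp w /(fsubsetP (msuppZ_le _ _)) /hp. Qed.

Lemma homog_free_sum m (I : Type) (r : seq I) (P : pred I) (f : I -> F) :
  (forall i, P i -> homog_free m (f i)) -> homog_free m (\sum_(i <- r | P i) f i).
Proof.
move=> h; apply: big_ind => //; [exact: homog_free0|exact: homog_freeD].
Qed.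

Lemma homog_freeM m k p q :
  homog_free m p -> homog_free k q -> homog_free (m + k) (p * q).
Proof.
move=> hp hq; rewrite -[p * q]/(fgmul _ _) /fgmul.
rewrite big_seq; apply: homog_free_sum => w /hp <-.
rewrite big_seq; apply: homog_free_sum => w' /hq <-.
by rewrite -wdegM; apply: homog_freeU.
Qed.

Lemma homog_free1 : homog_free 0 1.
Proof.
move=> w /(fsubsetP (@msuppU_le _ _ _ _)); rewrite in_fset1 => /eqP ->.
by rewrite fm1 /wdeg big_nil.
Qed.

Lemma homog0 m : homog m 0.
Proof. by exists 0; [exact: homog_free0|rewrite pa_class0]. Qed.

Lemma homogD m x y : homog m x -> homog m y -> homog m (x + y).
Proof.
move=> [p hp ->] [q hq ->]; exists (p + q); first exact: homog_freeD.
by rewrite pa_classD.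
Qed.

Lemma homogZ m (a : rat) x : homog m x -> homog m (a *: x).
Proof.
by move=> [p hp ->]; exists (a *: p); [exact: homog_freeZ|rewrite pa_classZ].
Qed.

Lemma homogM m k x y : homog m x -> homog k y -> homog (m + k) (x * y).
Proof.
move=> [p hp ->] [q hq ->]; exists (p * q); first exact: homog_freeM.
by rewrite pa_classM.
Qed.

Lemma homog1 : homog 0 1.
Proof. by exists 1; [exact: homog_free1|rewrite pa_class1]. Qed.

Lemma homog_fgen (x : X) : homog (deg x) (pa_class (fgen x)).
Proof.
exists (fgen x) => //; rewrite fgenE; have := @homog_freeU 1 (fmu x).
by rewrite /wdeg fmU big_seq1.
Qed.

Definition trunc (m : nat) (p : F) : F :=
  [malg w in msupp p => if wdeg w == m then p@_w else 0].

Lemma truncE m p w : (trunc m p)@_w = if wdeg w == m then p@_w else 0.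
Proof. by rewrite mcoeffE; case: msuppP => // _; case: ifP. Qed.

Lemma truncD m p q : trunc m (p + q) = trunc m p + trunc m q.
Proof.
by apply/malgP => w; rewrite mcoeffD !truncE mcoeffD; case: ifP; rewrite ?addr0.
Qed.

Lemma trunc0 m : trunc m 0 = 0.
Proof. by apply/malgP => w; rewrite truncE mcoeff0; case: ifP. Qed.

Lemma trunc_sum m (I : Type) (r : seq I) (P : pred I) (f : I -> F) :
  trunc m (\sum_(i <- r | P i) f i) = \sum_(i <- r | P i) trunc m (f i).
Proof. by apply: (big_morph (trunc m) (truncD m) (trunc0 m)). Qed.

Lemma trunc_homog m k p :
  homog_free k p -> trunc m p = if k == m then p else 0.
Proof.
move=> hp; apply/malgP => w; rewrite truncE.
have -> : (if k == m then p else 0)@_w = if k == m then p@_w else 0.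
  by case: ifP; rewrite ?mcoeff0.
by case: (msuppP p w) => [/hp <-//|_]; rewrite !if_same.
Qed.

Lemma homog_trunc m p : homog_free m (trunc m p).
Proof.
by move=> w; rewrite -mcoeff_neq0 truncE; case: (wdeg w =P m) => // _ /eqP.
Qed.

Lemma trunc_partition p : exists N, p = \sum_(m < N) trunc m p.
Proof.
exists (\max_(w <- msupp p) wdeg w).+1; apply/malgP => w.
rewrite raddf_sum /=; case: (msuppP p w) => [hw|hw]; last first.
  by rewrite big1 // => i _; rewrite truncE (mcoeff_outdom hw) if_same.
have lt : (wdeg w < (\max_(w <- msupp p) wdeg w).+1)%N.
  by rewrite ltnS; apply: (@leq_bigmax_seq _ _ xpredT (fun w : {fmonom X} => wdeg w)).
rewrite (bigD1 (Ordinal lt)) //= truncE eqxx big1 ?addr0 // => i ne.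
by rewrite truncE; case: eqP => // e; case/eqP: ne; apply: val_inj.
Qed.

Hypothesis R_homog :
  forall u v, R u v -> exists d, homog_free d u /\ homog_free d v.

Lemma ideal_gen_trunc m p : ideal_gen p -> ideal_gen (trunc m p).
Proof.
elim=> [|p1 p2 _ h1 _ h2|p1 u v p2 h]; first by rewrite trunc0; exact: ideal_gen0.
  by rewrite truncD; exact: ideal_genD.
have [d [hu hv]] := R_homog h.
have huv : homog_free d (u - v) by apply: homog_freeD => //; apply: homog_freeN.
elim/malg_ind: p1 => [|q1 q2 h1 h2|a w].
- by rewrite !mul0r trunc0; exact: ideal_gen0.
- by rewrite !mulrDl truncD; exact: ideal_genD.
elim/malg_ind: p2 => [|q1 q2 h1 h2|b w'].
- by rewrite mulr0 trunc0; exact: ideal_gen0.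
- by rewrite mulrDr truncD; exact: ideal_genD.
have hh := homog_freeM (homog_freeM (@homog_freeU a w) huv) (@homog_freeU b w').
by rewrite (trunc_homog m hh); case: ifP => _; [exact: ideal_gen_rel|exact: ideal_gen0].
Qed.

Lemma homog_direct N (f : nat -> presalg) :
  (forall m, homog m (f m)) -> \sum_(m < N) f m = 0 ->
  forall m, (m < N)%N -> f m = 0.
Proof.
move=> hf sum0 m ltm.
have [g hg] := choice (fun m => (let: ex_intro2 p h e := hf m in
  ex_intro (fun p => homog_free m p /\ f m = pa_class p) p (conj h e))).
have : ideal_gen (trunc m (\sum_(k < N) g k)).
  apply: ideal_gen_trunc; rewrite -[X in ideal_gen X]subr0; apply/pa_classP.
  rewrite pa_class0 raddf_sum -[RHS]sum0; apply: eq_bigr => k _.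
  by case: (hg k).
rewrite trunc_sum (bigD1 (Ordinal ltm)) //= big1 ?addr0 => [|k ne].
  have [hm ->] := hg m; rewrite (trunc_homog m hm) eqxx => h.
  by rewrite -pa_class0; apply/pa_classP; rewrite subr0.
have [hk _] := hg k; rewrite (trunc_homog m hk).
by case: eqP => // e; case/eqP: ne; apply: val_inj.
Qed.

End Degree.

Lemma homog_span (deg : X -> nat) x :
  exists N (f : nat -> presalg),
    (forall m, homog deg m (f m)) /\ x = \sum_(m < N) f m.
Proof.
have [N e] := trunc_partition deg (pa_repr x).
exists N, (fun m => pa_class (trunc deg m (pa_repr x))); split.
  by move=> m; exists (trunc deg m (pa_repr x)) => //; apply: homog_trunc.
by rewrite -[LHS]pa_reprK [X in pa_class X]e raddf_sum.
Qed.

(* A multiplicative function on words whose linear extension respects the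
   relations shows that the presented algebra is nontrivial. *)
Lemma pa_one_neq0 (h : {mmorphism {fmonom X} -> rat}) :
  (forall u v, R u v -> mmap idfun h u = mmap idfun h v) ->
  (1 : presalg) != 0.
Proof.
move=> hR; apply/eqP; rewrite -pa_class1 -pa_class0 => /pa_classP.
rewrite subr0 => h1.
have K p : ideal_gen p -> mmap idfun h p = 0.
  elim=> [|p1 p2 _ e1 _ e2|p1 u v p2 r]; first exact: mmap0.
    by rewrite mmapD e1 e2 addr0.
  by rewrite !rmorphM /= mmapB (hR _ _ r) subrr mulr0 mul0r.
by have /eqP := K _ h1; rewrite rmorph1 oner_eq0.
Qed.

End PresentedAlgebra.

Record grading (A : algType rat) := Grading {
  piece :> nat -> A -> Prop;
  piece0 : forall m, piece m 0;
  pieceD : forall m x y, piece m x -> piece m y -> piece m (x + y);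
  pieceZ : forall m (a : rat) x, piece m x -> piece m (a *: x);
  piece1 : piece 0 1;
  pieceM : forall m k x y, piece m x -> piece k y -> piece (m + k) (x * y);
  piece_span : forall x, exists N (f : nat -> A),
    (forall m, piece m (f m)) /\ x = \sum_(m < N) f m;
  piece_direct : forall N (f : nat -> A), (forall m, piece m (f m)) ->
    \sum_(m < N) f m = 0 -> forall m, (m < N)%N -> f m = 0
}.

(* The product of the homogeneous pieces: an element is the family of its
   homogeneous components. *)
Record completion (A : algType rat) (G : grading A) := Completion {
  comp : nat -> A;
  compP : forall m, G m (comp m)
}.

Section CompletionTheory.
Variables (A : algType rat) (G : grading A).
Local Notation C := (completion G).
Implicit Types f g h : C.

HB.instance Definition _ := gen_eqMixin C.
HB.instance Definition _ := gen_choiceMixin C.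

Lemma compE f g : (forall m, comp f m = comp g m) -> f = g.
Proof.
case: f g => [f hf] [g hg] /= /funext e; rewrite -e in hg *.
by congr Completion; apply: Prop_irrelevance.
Qed.

Lemma piece_sum m (I : Type) (r : seq I) (P : pred I) (F : I -> A) :
  (forall i, P i -> G m (F i)) -> G m (\sum_(i <- r | P i) F i).
Proof.
by move=> h; apply: big_ind => //; [exact: piece0|move=> x y; apply: pieceD].
Qed.

Lemma pieceN m x : G m x -> G m (- x).
Proof. by move=> hx; rewrite -scaleN1r; apply: pieceZ. Qed.

(* The element concentrated in degree [m]. *)
Fact inj_proof m (x : A) (hx : G m x) k : G k (if k == m then x else 0).
Proof. by case: eqP => [->|_] //; apply: piece0. Qed.
Definition inj_piece m (x : A) (hx : G m x) : C := Completion (inj_proof hx).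

Definition co_zero : C := Completion (@piece0 A G).
Definition co_one : C := inj_piece (piece1 G).
Definition co_opp f : C := Completion (fun m => pieceN (compP f m)).
Definition co_add f g : C := Completion (fun m => pieceD (compP f m) (compP g m)).
Definition co_scale (a : rat) f : C :=
  Completion (fun m => pieceZ a (compP f m)).

Fact co_mul_proof f g m : G m (\sum_(i < m.+1) comp f i * comp g (m - i)).
Proof.
apply: piece_sum => i _; rewrite -{1}(subnKC (leq_ord i)).
by apply: pieceM; apply: compP.
Qed.
Definition co_mul f g : C := Completion (co_mul_proof f g).

Lemma co_addA : associative co_add.
Proof. by move=> f g h; apply: compE => m; apply: addrA. Qed.
Lemma co_addC : commutative co_add.
Proof. by move=> f g; apply: compE => m; apply: addrC. Qed.
Lemma co_add0 : left_id co_zero co_add.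
Proof. by move=> f; apply: compE => m; apply: add0r. Qed.
Lemma co_addN : left_inverse co_zero co_opp co_add.
Proof. by move=> f; apply: compE => m; apply: addNr. Qed.

HB.instance Definition _ :=
  GRing.isZmodule.Build C co_addA co_addC co_add0 co_addN.

Let tpoly N f : {poly A} := \poly_(i < N) comp f i.

Lemma comp_mul_poly N f g m : (m < N)%N ->
  comp (co_mul f g) m = (tpoly N f * tpoly N g)`_m.
Proof.
move=> lt; rewrite coefM /=; apply: eq_bigr => i _; rewrite !coef_poly.
rewrite (leq_ltn_trans (leq_ord i) lt).
by rewrite (leq_ltn_trans (leq_subr i m) lt).
Qed.

Lemma co_mulA : associative co_mul.
Proof.
move=> f g h; apply: compE => m; set P := tpoly m.+1.
transitivity ((P f * (P g * P h))`_m).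
  rewrite coefM [LHS]/=; apply: eq_bigr => i _; rewrite coef_poly ltn_ord.
  by rewrite -comp_mul_poly // ltnS leq_subr.
rewrite mulrA coefM [RHS]/=; apply: eq_bigr => i _.
by rewrite -comp_mul_poly // coef_poly ltnS leq_subr.
Qed.

Lemma co_mul1 : left_id co_one co_mul.
Proof.
move=> f; apply: compE => m /=.
by rewrite big_ord_recl /= mul1r subn0 big1 ?addr0 // => i _; rewrite mul0r.
Qed.

Lemma co_mulr1 : right_id co_one co_mul.
Proof.
move=> f; apply: compE => m /=.
rewrite big_ord_recr /= subnn mulr1 big1 ?add0r // => i _.
by rewrite subn_eq0 leqNgt ltn_ord mulr0.
Qed.

Lemma co_mulDl : left_distributive co_mul co_add.
Proof.
move=> f g h; apply: compE => m /=; rewrite -big_split.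
by apply: eq_bigr => i _; rewrite mulrDl.
Qed.

Lemma co_mulDr : right_distributive co_mul co_add.
Proof.
move=> f g h; apply: compE => m /=; rewrite -big_split.
by apply: eq_bigr => i _; rewrite mulrDr.
Qed.

Lemma co_one_neq0 : co_one != 0.
Proof. by apply/eqP => /(congr1 (fun f => comp f 0)) /eqP; rewrite oner_eq0. Qed.

HB.instance Definition _ := GRing.Zmodule_isNzRing.Build C
  co_mulA co_mul1 co_mulr1 co_mulDl co_mulDr co_one_neq0.

Lemma co_scaleA a b f : co_scale a (co_scale b f) = co_scale (a * b) f.
Proof. by apply: compE => m; apply: scalerA. Qed.
Lemma co_scale1 : left_id 1 co_scale.
Proof. by move=> f; apply: compE => m; apply: scale1r. Qed.
Lemma co_scaleDr : right_distributive co_scale +%R.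
Proof. by move=> a f g; apply: compE => m; apply: scalerDr. Qed.
Lemma co_scaleDl f : {morph co_scale^~ f : a b / a + b}.
Proof. by move=> a b; apply: compE => m; apply: scalerDl. Qed.

HB.instance Definition _ := GRing.Zmodule_isLmodule.Build rat C
  co_scaleA co_scale1 co_scaleDr co_scaleDl.

Lemma co_scaleAl (a : rat) f g : a *: (f * g) = (a *: f) * g.
Proof.
apply: compE => m /=; rewrite scaler_sumr.
by apply: eq_bigr => i _; rewrite scalerAl.
Qed.
HB.instance Definition _ := GRing.Lmodule_isLalgebra.Build rat C co_scaleAl.

Lemma co_scaleAr (a : rat) f g : a *: (f * g) = f * (a *: g).
Proof.
apply: compE => m /=; rewrite scaler_sumr.
by apply: eq_bigr => i _; rewrite scalerAr.
Qed.
HB.instance Definition _ := GRing.Lalgebra_isAlgebra.Build rat C co_scaleAr.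

Lemma comp0 m : comp (0 : C) m = 0. Proof. by []. Qed.
Lemma compD f g m : comp (f + g) m = comp f m + comp g m. Proof. by []. Qed.
Lemma compN f m : comp (- f) m = - comp f m. Proof. by []. Qed.
Lemma compZ (a : rat) f m : comp (a *: f) m = a *: comp f m. Proof. by []. Qed.
Lemma compM f g m : comp (f * g) m = \sum_(i < m.+1) comp f i * comp g (m - i).
Proof. by []. Qed.
Lemma comp1 m : comp (1 : C) m = if m == 0%N then 1 else 0. Proof. by []. Qed.
Lemma comp_inj m x (hx : G m x) k :
  comp (inj_piece hx) k = if k == m then x else 0.
Proof. by []. Qed.

Fact cexp_proof f m : G m (\sum_(k < m.+1) (k`!%:R^-1 : rat) *: comp (f ^+ k) m).
Proof. by apply: piece_sum => k _; apply: pieceZ; apply: compP. Qed.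

(* The exponential series [\sum_k f ^+ k / k!] of an element [f] with zero
   component in degree 0 (the only ones it is used for): [f ^+ k] then vanishes
   in degrees below [k], so that truncating at [k <= m] loses nothing in
   degree [m]. *)
Definition cexp f : C := Completion (cexp_proof f).

Lemma comp_expr_lt f k m : comp f 0 = 0 -> (m < k)%N -> comp (f ^+ k) m = 0.
Proof.
move=> f0; elim: k m => [|k IH] m; first by rewrite ltn0.
move=> lt; rewrite exprS compM big_ord_recl f0 mul0r add0r big1 // => i _.
rewrite IH ?mulr0 // lift0; have := ltn_ord i; lia.
Qed.

Lemma comp_cexp f N m : comp f 0 = 0 -> (m < N)%N ->
  comp (cexp f) m = \sum_(k < N) (k`!%:R^-1 : rat) *: comp (f ^+ k) m.
Proof.
move=> f0 lt /=.
rewrite -!(big_mkord xpredT (fun k => (k`!%:R^-1 : rat) *: comp (f ^+ k) m)).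
rewrite (big_cat_nat (n := m.+1) (leq0n _) lt) /= [X in _ + X]big_nat.
by rewrite [X in _ + X]big1 ?addr0 // => k /andP[lt' _]; rewrite comp_expr_lt ?scaler0.
Qed.

Definition homogeneous (m : nat) f : Prop :=
  forall k, k != m -> comp f k = 0.

Definition higher_terms (m : nat) f : Prop :=
  forall k, (k <= m)%N -> comp f k = 0.

End CompletionTheory.

(* For [n] strands the index [i : 'I_n.-1] counts the pairs of adjacent strands
   from 0: it involves the positions [strand i] and [strandS i], of values [i]
   and [i.+1]. *)
Fact strand_proof n (i : 'I_n.-1) : (i < n)%N.
Proof. by case: n i => [|n] [i hi] //=; apply: ltnW. Qed.
Fact strandS_proof n (i : 'I_n.-1) : (i.+1 < n)%N.
Proof. by case: n i => [|n] [i hi]. Qed.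
Definition strand n (i : 'I_n.-1) : 'I_n := Ordinal (strand_proof i).
Definition strandS n (i : 'I_n.-1) : 'I_n := Ordinal (strandS_proof i).

Lemma strand_neq n (i : 'I_n.-1) : strand i != strandS i.
Proof. by rewrite -val_eqE /= ltn_eqF. Qed.

Section WBraids.
Variable n : nat.

(* [inl i] is the crossing sigma_i and [inr i] the virtual crossing s_i. *)
Definition wgen : Type := ('I_n.-1 + 'I_n.-1)%type.
HB.instance Definition _ := Choice.on wgen.

Definition crossing (i : 'I_n.-1) (b : bool) : wgen * bool := (inl i, b).
Definition virtual (i : 'I_n.-1) : wgen * bool := (inr i, true).

Definition distant (i j : 'I_n.-1) : bool := (i.+1 < j)%N || (j.+1 < i)%N.

Local Notation sg i := (crossing i true).
Local Notation s := virtual.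

Inductive wB_rel : gword wgen -> gword wgen -> Prop :=
| wB_s2 i : wB_rel [:: s i; s i] [::]
| wB_s_braid (i j : 'I_n.-1) : j = i.+1 :> nat -> wB_rel [:: s i; s j; s i] [:: s j; s i; s j]
| wB_s_far (i j : 'I_n.-1) : distant i j -> wB_rel [:: s i; s j] [:: s j; s i]
| wB_sigma_braid (i j : 'I_n.-1) : j = i.+1 :> nat -> wB_rel [:: sg i; sg j; sg i] [:: sg j; sg i; sg j]
| wB_sigma_far (i j : 'I_n.-1) : distant i j -> wB_rel [:: sg i; sg j] [:: sg j; sg i]
| wB_mixed (i j : 'I_n.-1) b : j = i.+1 :> nat ->
    wB_rel [:: s i; crossing j b; s i] [:: s j; crossing i b; s j]
| wB_mixed_far (i j : 'I_n.-1) : distant i j -> wB_rel [:: s i; sg j] [:: sg j; s i]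
| wB_OC (i j : 'I_n.-1) : j = i.+1 :> nat -> wB_rel [:: sg i; sg j; s i] [:: s j; sg i; sg j].

Definition wB : groupType := presgroup wB_rel.

Definition wB_sigma (i : 'I_n.-1) : wB := gclass wB_rel [:: crossing i true].
Definition wB_s (i : 'I_n.-1) : wB := gclass wB_rel [:: virtual i].

End WBraids.

Section ArrowDiagrams.
Variable n : nat.

Definition agen : Type := ({p : 'I_n * 'I_n | p.1 != p.2} + {perm 'I_n})%type.
HB.instance Definition _ := Choice.on agen.

Definition fa (i j : 'I_n) (ij : i != j) : freealg agen :=
  fgen (inl (exist _ (i, j) ij) : agen).
Definition fperm (t : {perm 'I_n}) : freealg agen := fgen (inr t : agen).

(* Products in [{perm 'I_n}] are read from left to right: [(t * t') i] is
   [t' (t i)]. *)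
Inductive Aw_rel : freealg agen -> freealg agen -> Prop :=
| Aw_perm1 : Aw_rel (fperm 1%g) 1
| Aw_permM t t' : Aw_rel (fperm t * fperm t') (fperm (t * t')%g)
| Aw_far i j k l (ij : i != j) (kl : k != l) : uniq [:: i; j; k; l] ->
    Aw_rel (fa ij * fa kl) (fa kl * fa ij)
| Aw_TC i j k (ij : i != j) (ik : i != k) : uniq [:: i; j; k] ->
    Aw_rel (fa ij * fa ik) (fa ik * fa ij)
| Aw_4T i j k (ij : i != j) (ik : i != k) (jk : j != k) :
    Aw_rel ((fa ij + fa ik) * fa jk) (fa jk * (fa ij + fa ik))
| Aw_act (i j : 'I_n) (t : {perm 'I_n}) (ij : i != j) (tij : t i != t j) :
    Aw_rel (fa ij * fperm t) (fperm t * fa tij).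

Definition adeg (x : agen) : nat := if x is inl _ then 1 else 0.

Local Notation hfree := (homog_free adeg).

Lemma hfree_fa i j (ij : i != j) : hfree 1 (fa ij).
Proof.
rewrite /fa fgenE; have := @homog_freeU _ adeg 1 (fmu (inl (exist _ (i, j) ij) : agen)).
by rewrite /wdeg fmU big_seq1.
Qed.

Lemma hfree_fperm t : hfree 0 (fperm t).
Proof.
rewrite /fperm fgenE; have := @homog_freeU _ adeg 1 (fmu (inr t : agen)).
by rewrite /wdeg fmU big_seq1.
Qed.

Lemma Aw_rel_homog u v : Aw_rel u v -> exists d, hfree d u /\ hfree d v.
Proof.
case=> [|t t'|i j k l ij kl _|i j k ij ik _|i j k ij ik jk|i j t ij tij].
- by exists 0%N; split; [exact: hfree_fperm|exact: homog_free1].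
- exists 0%N; split; last exact: hfree_fperm.
  exact: (@homog_freeM _ adeg 0 0 _ _ (@hfree_fperm t) (@hfree_fperm t')).
- exists 2%N; split; first exact: (@homog_freeM _ adeg 1 1 _ _ (@hfree_fa _ _ ij) (@hfree_fa _ _ kl)).
  exact: (@homog_freeM _ adeg 1 1 _ _ (@hfree_fa _ _ kl) (@hfree_fa _ _ ij)).
- exists 2%N; split; first exact: (@homog_freeM _ adeg 1 1 _ _ (@hfree_fa _ _ ij) (@hfree_fa _ _ ik)).
  exact: (@homog_freeM _ adeg 1 1 _ _ (@hfree_fa _ _ ik) (@hfree_fa _ _ ij)).
- have h := homog_freeD (@hfree_fa _ _ ij) (@hfree_fa _ _ ik).
  exists 2%N; split; first exact: (@homog_freeM _ adeg 1 1 _ _ h (@hfree_fa _ _ jk)).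
  exact: (@homog_freeM _ adeg 1 1 _ _ (@hfree_fa _ _ jk) h).
- exists 1%N; split; first exact: (@homog_freeM _ adeg 1 0 _ _ (@hfree_fa _ _ ij) (@hfree_fperm t)).
  exact: (@homog_freeM _ adeg 0 1 _ _ (@hfree_fperm t) (@hfree_fa _ _ tij)).
Qed.

(* The augmentation killing the arrows and sending permutations to 1. *)
Definition aug (w : {fmonom agen}) : rat := (wdeg adeg w == 0)%:R.

Fact aug_mmorphism : mmorphism aug.
Proof.
split=> [w w'|]; last by rewrite /aug /wdeg fm1 big_nil.
by rewrite /aug wdegM addn_eq0 -natrM mulnb.
Qed.
HB.instance Definition _ := isMultiplicative.Build _ rat aug aug_mmorphism.

Definition Aw_alg : Type := presalg Aw_rel.
HB.instance Definition _ := GRing.PzRing.on Aw_alg.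
HB.instance Definition _ := GRing.Lmodule.on Aw_alg.

Fact Aw_one_neq0 : (1 : Aw_alg) != 0.
Proof.
pose e (p : freealg agen) : rat := mmap idfun aug p.
have ea i j (ij : i != j) : e (fa ij) = 0.
  by rewrite /e /fa fgenE mmapU /aug /wdeg fmU big_seq1 mulr0.
have ep t : e (fperm t) = 1 by rewrite /e /fperm fgenE mmapU /aug /wdeg fmU big_seq1 mulr1.
have eM p q : e (p * q) = e p * e q by rewrite /e rmorphM.
have e0l p q : e p = 0 -> e (p * q) = 0 by rewrite eM => ->; rewrite mul0r.
have e0r p q : e q = 0 -> e (p * q) = 0 by rewrite eM => ->; rewrite mulr0.
have e1 : e 1 = 1 by rewrite /e rmorph1.
apply: (@pa_one_neq0 _ _ aug) => u v h; rewrite -/(e u) -/(e v).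
case: h => [|t t'|i j k l ij kl _|i j k ij ik _|i j k ij ik jk|i j t ij tij].
- exact: etrans (ep _) (esym e1).
- exact: etrans (eM _ _) (etrans (congr2 *%R (ep t) (ep t')) (esym (ep _))).
- exact: etrans (e0l _ _ (ea _ _ ij)) (esym (e0r _ _ (ea _ _ ij))).
- exact: etrans (e0l _ _ (ea _ _ ij)) (esym (e0r _ _ (ea _ _ ij))).
- exact: etrans (e0r _ _ (ea _ _ jk)) (esym (e0l _ _ (ea _ _ jk))).
- exact: etrans (e0l _ _ (ea _ _ ij)) (esym (e0r _ _ (ea _ _ tij))).
Qed.
HB.instance Definition _ := GRing.PzSemiRing_isNonZero.Build Aw_alg Aw_one_neq0.
HB.instance Definition _ :=
  GRing.Lmodule_isLalgebra.Build rat Aw_alg (@pa_scalerAl _ Aw_rel).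
HB.instance Definition _ :=
  GRing.Lalgebra_isAlgebra.Build rat Aw_alg (@pa_scalerAr _ Aw_rel).

Definition Aw_grading : grading Aw_alg :=
  @Grading Aw_alg (@homog _ Aw_rel adeg)
    (@homog0 _ Aw_rel adeg) (@homogD _ Aw_rel adeg) (@homogZ _ Aw_rel adeg)
    (@homog1 _ Aw_rel adeg) (@homogM _ Aw_rel adeg)
    (@homog_span _ Aw_rel adeg) (@homog_direct _ Aw_rel adeg Aw_rel_homog).

Definition Aw : algType rat := completion Aw_grading.

Fact arrow_proof i j (ij : i != j) : Aw_grading 1 (pa_class Aw_rel (fa ij)).
Proof. exact: (@homog_fgen _ Aw_rel adeg (inl (exist _ (i, j) ij) : agen)). Qed.
Definition arrow (i j : 'I_n) (ij : i != j) : Aw := inj_piece (arrow_proof ij).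

Fact permA_proof t : Aw_grading 0 (pa_class Aw_rel (fperm t)).
Proof. exact: (@homog_fgen _ Aw_rel adeg (inr t : agen)). Qed.
Definition permA (t : {perm 'I_n}) : Aw := inj_piece (permA_proof t).

Definition adj_arrow (i : 'I_n.-1) : Aw := arrow (strand_neq i).
Definition adj_tperm (i : 'I_n.-1) : Aw := permA (tperm (strand i) (strandS i)).

End ArrowDiagrams.

Section Expansion.
Variable n : nat.

(* The formal inverse of [s_i] receives the value [s_i], as [s_i] is an
   involution. *)
Definition Zletter (l : wgen n * bool) : Aw n :=
  match l with
  | (inl i, true) => cexp (adj_arrow i) * adj_tperm i
  | (inl i, false) => adj_tperm i * cexp (- adj_arrow i)
  | (inr i, _) => adj_tperm i
  end.

Definition Zword (w : gword (wgen n)) : Aw n := \prod_(l <- w) Zletter l.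

Inductive sletter : Type :=
| Crossing of 'I_n.-1 & bool
| Virtual of 'I_n.-1
| SemiVirtual of 'I_n.-1 & bool.

Definition is_semivirtual (l : sletter) : bool :=
  if l is SemiVirtual _ _ then true else false.

Definition singularity (w : seq sletter) : nat := count is_semivirtual w.

Definition sletter_ga (l : sletter) : groupalg (wB n) :=
  match l with
  | Crossing i true => ga_of (wB_sigma i)
  | Crossing i false => ga_of (wB_sigma i)^-1%g
  | Virtual i => ga_of (wB_s i)
  | SemiVirtual i true => ga_of (wB_sigma i) - ga_of (wB_s i)
  | SemiVirtual i false => ga_of (wB_s i) - ga_of (wB_sigma i)^-1%g
  end.

Definition singular_ga (w : seq sletter) : groupalg (wB n) :=
  \prod_(l <- w) sletter_ga l.

Definition sletter_diagram (l : sletter) : Aw n :=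
  match l with
  | Crossing i _ | Virtual i => adj_tperm i
  | SemiVirtual i true => adj_arrow i * adj_tperm i
  | SemiVirtual i false => adj_tperm i * adj_arrow i
  end.

Definition diagram (w : seq sletter) : Aw n := \prod_(l <- w) sletter_diagram l.

End Expansion.

(* Main.v *)
Require Import Defs.
From mathcomp Require Import all_boot all_order all_fingroup all_algebra.
From mathcomp Require Import monalg finmap zify.

Import GRing.Theory.
Local Open Scope ring_scope.

(* Pushing all permutations to the right with [t * exp f = exp g * t], where [t]
   carries the arrow [g] to [f], every relation of the w-braid group becomes an
   identity between exponentials followed by an identity in the symmetric group.
   On three strands the third Reidemeister move becomes
     exp a_pq exp a_pr exp a_qr = exp a_qr exp a_pr exp a_pq,
   which holds because TC makes the left-hand side exp (a_pq + a_pr) exp a_qr and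
   4T says that [a_pq + a_pr] commutes with [a_qr]; TC alone gives the relation
   that overcrossings commute.  The leading term of a product is the product of
   the leading terms, so the expansion property need only be checked on letters,
   where it says that exp a = 1 + a + (higher degree). *)

Local Notation comp := Defs.comp.

(** * Exponential series in a completed graded algebra *)

Section Completion.
Context {A : algType rat} {G : grading A}.
Local Notation C := (completion G).
Implicit Types f g h u D E : C.

Lemma comp_sum I (r : seq I) (P : pred I) (F : I -> C) m :
  comp (\sum_(i <- r | P i) F i) m = \sum_(i <- r | P i) comp (F i) m.
Proof. exact: (big_morph (fun f => comp f m)). Qed.

(** Degree [m] of a product sees only degrees up to [m] of its factors, so series may be replaced
    there by polynomials that agree with them. *)
Lemma comp_mul_eq f f' g g' N m :
  (forall k, (k < N)%N -> comp f k = comp f' k) ->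
  (forall k, (k < N)%N -> comp g k = comp g' k) ->
  (m < N)%N -> comp (f * g) m = comp (f' * g') m.
Proof.
move=> ef eg ltm; rewrite !compM; apply: eq_bigr => i _.
by rewrite ef ?eg //; have := ltn_ord i; lia.
Qed.

(** A finite sum, so that distributivity and the binomial formula apply; [cexp] itself is only given
    degree by degree. *)
Definition exp_partial N f : C := \sum_(0 <= k < N) (k`!%:R^-1 : rat) *: f ^+ k.

Lemma comp_exp_partial N f m : comp f 0 = 0 -> (m < N)%N ->
  comp (cexp f) m = comp (exp_partial N f) m.
Proof.
move=> f0 lt; rewrite (comp_cexp f0 lt) /exp_partial big_mkord comp_sum.
by apply: eq_bigr => k _; rewrite compZ.
Qed.

(** In each degree the exponentials may be truncated, and [u * f ^+ k = g ^+ k * u] follows by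
    induction on [k]. *)
Lemma cexp_intertwine u f g : comp f 0 = 0 -> comp g 0 = 0 ->
  u * f = g * u -> u * cexp f = cexp g * u.
Proof.
move=> f0 g0 ufg; apply: compE => m.
rewrite (@comp_mul_eq _ u _ (exp_partial m.+1 f) m.+1) //; last first.
  by move=> k lt; apply: comp_exp_partial.
rewrite [RHS](@comp_mul_eq _ (exp_partial m.+1 g) _ u m.+1) //; last first.
  by move=> k lt; apply: comp_exp_partial.
congr (comp _ m); rewrite /exp_partial mulr_sumr mulr_suml.
apply: eq_bigr => k _; rewrite -scalerAr -scalerAl; congr (_ *: _).
elim: k => [|k IH]; first by rewrite !expr0 mulr1 mul1r.
by rewrite exprSr mulrA IH -mulrA ufg mulrA -exprSr.
Qed.

(** Exchanging the summations and shifting the inner index by [i] turns the antidiagonals into the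
    rows of the triangle [i + j < N]. *)
Lemma sum_triangle (V : zmodType) (F : nat -> nat -> V) N :
  \sum_(0 <= k < N) \sum_(0 <= i < k.+1) F i (k - i)%N =
  \sum_(0 <= i < N) \sum_(0 <= j < N - i) F i j.
Proof.
transitivity (\sum_(0 <= k < N) \sum_(0 <= i < N | (i <= k)%N) F i (k - i)%N).
  rewrite big_nat [RHS]big_nat; apply: eq_bigr => k ltk.
  by rewrite (big_nat_widen _ _ N).
rewrite (exchange_big_dep_nat xpredT) //=; apply: eq_bigr => i _.
transitivity (\sum_(i <= k < N) F i (k - i)%N).
  rewrite [RHS](big_nat_widenl _ 0%N) //.
rewrite -{1}[i]add0n big_addn; apply: eq_bigr => j _.
by rewrite addnK.
Qed.

Lemma comp_exprM_lt f g i j m : comp f 0 = 0 -> comp g 0 = 0 ->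
  (m < i + j)%N -> comp (f ^+ i * g ^+ j) m = 0.
Proof.
move=> f0 g0 lt; rewrite compM big1 // => k _.
have [lti|gei] := ltnP k i; first by rewrite (comp_expr_lt f0 lti) mul0r.
by rewrite (@comp_expr_lt _ _ g) ?mulr0 //; have := ltn_ord k; lia.
Qed.

(** The binomial formula yields the terms of the triangle [i + j < N], the product of the partial
    sums those of the whole square. The difference lives in degrees at least [N], beyond [m]. *)
Lemma cexpD f g : comp f 0 = 0 -> comp g 0 = 0 -> f * g = g * f ->
  cexp (f + g) = cexp f * cexp g.
Proof.
move=> f0 g0 fg; apply: compE => m; set N := m.+1.
have fg0 : comp (f + g) 0 = 0 by rewrite compD f0 g0 addr0.
rewrite (@comp_exp_partial N) //.
rewrite [RHS](@comp_mul_eq _ (exp_partial N f) _ (exp_partial N g) N) //;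
  try by move=> k lt; apply: comp_exp_partial.
pose F i j : C := (i`!%:R^-1 * j`!%:R^-1 : rat) *: (f ^+ i * g ^+ j).
(* The coefficients match because the binomial coefficient divided by [k!] is the inverse of
   [i! * (k - i)!]. *)
have -> : exp_partial N (f + g) = \sum_(0 <= k < N) \sum_(0 <= i < k.+1) F (k - i)%N i.
  apply: eq_bigr => k _; rewrite (exprDn_comm _ fg) big_mkord scaler_sumr.
  apply: eq_bigr => i _; rewrite -scaler_nat scalerA; congr (_ *: _).
  have lei : (i <= k)%N by rewrite -ltnS.
  rewrite -(bin_fact lei) !natrM !invfM.
  have h : ('C(k, i)%:R : rat) != 0 by rewrite Num.Theory.pnatr_eq0 -lt0n bin_gt0.
  by rewrite mulrAC mulVf // mul1r mulrC.
(* The binomial index is the exponent of [g], hence the swapped arguments: [j], the exponent of [g],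
   becomes the outer index. *)
rewrite (sum_triangle _ (fun i j => F j i)).
rewrite /exp_partial mulr_sumr !comp_sum; apply: eq_big_nat => j ltj.
rewrite mulr_suml !comp_sum.
under [RHS]eq_bigr => i _ do rewrite -scalerAl -scalerAr scalerA -/(F i j).
(* Each row of the square is cut at [N - j]; the part beyond it has [i + j >= N > m] and vanishes in
   degree [m]. *)
rewrite -[LHS]addr0 (big_cat_nat (leq0n _) (leq_subr j N)); congr (_ + _).
rewrite big_nat big1 // => i lti.
rewrite compZ comp_exprM_lt ?scaler0 //; lia.
Qed.

Lemma cexp_comm f g : comp f 0 = 0 -> comp g 0 = 0 -> f * g = g * f ->
  cexp f * cexp g = cexp g * cexp f.
Proof.
move=> f0 g0 fg; apply: cexp_intertwine => //.
by apply/esym/cexp_intertwine.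
Qed.

Lemma cexp_yang_baxter f g h :
  comp f 0 = 0 -> comp g 0 = 0 -> comp h 0 = 0 ->
  f * g = g * f -> (f + g) * h = h * (f + g) ->
  cexp f * cexp g * cexp h = cexp h * cexp g * cexp f.
Proof.
move=> f0 g0 h0 fg fgh; rewrite -[RHS]mulrA (@cexp_comm g f) //.
by rewrite -cexpD // cexp_comm // compD f0 g0 addr0.
Qed.

Lemma cexp0 : cexp 0 = 1 :> C.
Proof.
apply: compE => m; rewrite (@comp_cexp _ _ _ m.+1) // big_ord_recl expr0 fact0.
rewrite invr1 scale1r big1 ?addr0 // => i _.
by rewrite lift0 expr0n scaler0.
Qed.

Lemma cexpNr f : comp f 0 = 0 -> cexp f * cexp (- f) = 1.
Proof.
move=> f0; rewrite -cexpD ?compN ?f0 ?oppr0 ?subrr ?cexp0 //.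
by rewrite mulrN mulNr.
Qed.

Lemma comp_cexp0 f : comp f 0 = 0 -> comp (cexp f) 0 = 1.
Proof.
move=> f0; rewrite (@comp_cexp _ _ _ 1) // big_ord_recl big_ord0 addr0.
by rewrite fact0 invr1 scale1r expr0 comp1.
Qed.

Lemma comp_cexp1 f : comp f 0 = 0 -> comp (cexp f) 1 = comp f 1.
Proof.
move=> f0; rewrite (@comp_cexp _ _ _ 2) // !big_ord_recl big_ord0 addr0.
by rewrite expr0 comp1 scaler0 add0r lift0 factS fact0 muln1 invr1 scale1r expr1.
Qed.

(** * Homogeneous elements and leading terms *)

Lemma inj_piece_eq m x y (hx : G m x) (hy : G m y) :
  x = y -> inj_piece hx = inj_piece hy.
Proof. by move=> e; apply: compE => k; rewrite !comp_inj e. Qed.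

Lemma inj_pieceD m x y (hx : G m x) (hy : G m y) :
  inj_piece hx + inj_piece hy = inj_piece (pieceD hx hy).
Proof. by apply: compE => k; rewrite compD !comp_inj; case: ifP; rewrite ?addr0. Qed.

(** Together with [inj_pieceD], this transports the relations of the presented algebra to its
    completion. *)
Lemma inj_pieceM a b x y (hx : G a x) (hy : G b y) :
  inj_piece hx * inj_piece hy = inj_piece (pieceM hx hy).
Proof.
apply: compE => m; rewrite compM comp_inj.
have [le|lt] := leqP a m; last first.
  rewrite big1 => [|i _]; first by case: eqP => // e; lia.
  by rewrite comp_inj; case: eqP => [e|]; rewrite ?mul0r //; have := ltn_ord i; lia.
have lta : (a < m.+1)%N by [].
rewrite (bigD1 (Ordinal lta)) // -[RHS]addr0; congr (_ + _).
  rewrite !comp_inj eqxx (_ : (_ == b) = (m == a + b)%N) /=; last by lia.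
  by case: ifP; rewrite ?mulr0.
apply: big1 => i ne; rewrite comp_inj; case: eqP => [e|]; rewrite ?mul0r //.
by case/eqP: ne; apply: val_inj.
Qed.

Lemma inj_piece_homogeneous m x (hx : G m x) : homogeneous m (inj_piece hx).
Proof. by move=> k /negPf ne; rewrite comp_inj ne. Qed.

(** [D] may be zero, so that the notion stays multiplicative in the presence of zero divisors. *)
Definition leading_term m D f : Prop :=
  homogeneous m D /\ forall k, (k <= m)%N -> comp f k = comp D k.

Lemma leading_term1 : leading_term 0 1 1.
Proof. by split=> // k ne; rewrite comp1 (negPf ne). Qed.

Lemma leading_term_higher {m D f} : leading_term m D f ->
  exists2 r, higher_terms m r & f = D + r.
Proof.
move=> [_ e]; exists (f - D); last by rewrite addrC subrK.
by move=> k le; rewrite compD compN e // subrr.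
Qed.

(** In degree [k <= a + b], a summand with [i > a] has [k - i < b], where [g] and [E] vanish; one
    with [k - i > b] has [i < a], where [f] and [D] vanish. In the remaining summands the factors
    agree. *)
Lemma leading_termM {a b D E f g} : leading_term a D f -> leading_term b E g ->
  leading_term (a + b) (D * E) (f * g).
Proof.
move=> [hD ef] [hE eg]; split=> [k ne|k le]; rewrite !compM.
  apply: big1 => i _; have [ei|nei] := eqVneq (i : nat) a.
    by rewrite (hE (k - i)%N) ?mulr0 //; have := ltn_ord i; lia.
  by rewrite hD ?mul0r.
apply: eq_bigr => i _; have lti := ltn_ord i.
have [lea|lta] := leqP i a; last first.
  by rewrite eg ?(hE (k - i)%N) ?mulr0 //; lia.
rewrite ef //; have [leb|ltb] := leqP (k - i)%N b; first by rewrite eg.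
by rewrite (hD i) ?mul0r //; lia.
Qed.

End Completion.

(** * Linear extension to the group ring *)

Section LinearExtension.
Context {G : groupType} {V : lmodType rat} (f : G -> V).
Implicit Types p q : groupalg G.

(** Allows elements with different supports to be summed over one common set. *)
Lemma linextE (d : {fset G}) p : (msupp p `<=` d)%fset ->
  linext f p = \sum_(g <- d) p@_g *: f g.
Proof.
move=> le; apply: big_fset_incl => // g _ /mcoeff_outdom ->.
by rewrite scale0r.
Qed.

Lemma linext0 : linext f 0 = 0.
Proof. by rewrite /linext msupp0 big_seq_fset0. Qed.

Lemma linextD p q : linext f (p + q) = linext f p + linext f q.
Proof.
pose d := (msupp p `|` msupp q)%fset.
rewrite (@linextE d (p + q)) ?msuppD_le // (@linextE d p) ?fsubsetUl //.
rewrite (@linextE d q) ?fsubsetUr // -big_split.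
by apply: eq_bigr => g _; rewrite mcoeffD scalerDl.
Qed.

Lemma linextN p : linext f (- p) = - linext f p.
Proof. by apply: (addIr (linext f p)); rewrite -linextD !addNr linext0. Qed.

Lemma linextU a g : linext f (<< a *g g >> : groupalg G) = a *: f g.
Proof. by rewrite (@linextE [fset g]%fset) ?msuppU_le // big_seq_fset1 mcoeffUU. Qed.

Lemma linext_ga_of g : linext f (ga_of g) = f g.
Proof. by rewrite linextU scale1r. Qed.

End LinearExtension.

Lemma linextM {G : groupType} {V : algType rat} {f : G -> V}
    (fM : forall g h, f (g * h)%g = f g * f h) (p q : groupalg G) :
  linext f (p * q) = linext f p * linext f q.
Proof.
elim/malg_ind: p => [|p1 p2 h1 h2|a g]; first by rewrite mul0r linext0 mul0r.
  by rewrite mulrDl !linextD h1 h2 mulrDl.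
elim/malg_ind: q => [|q1 q2 h1 h2|b h]; first by rewrite mulr0 linext0 mulr0.
  by rewrite mulrDr !linextD h1 h2 mulrDr.
rewrite -[X in linext f X]/(ga_mul _ _) ga_mulUU !linextU fM.
by rewrite -scalerAl -scalerAr scalerA.
Qed.

(** * Relations between arrows and permutations in the completed algebra *)

Section Relations.
Context {n : nat}.

Lemma permA1 : permA 1%g = 1 :> Aw n.
Proof. exact/inj_piece_eq/pa_class_rel/Aw_perm1. Qed.

Lemma permAM (t t' : {perm 'I_n}) : permA (t * t')%g = permA t * permA t'.
Proof.
rewrite [RHS]inj_pieceM; apply: inj_piece_eq.
by rewrite -pa_classM; apply/esym/pa_class_rel/Aw_permM.
Qed.

Lemma arrow_far {i j k l : 'I_n} (ij : i != j) (kl : k != l) :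
  uniq [:: i; j; k; l] -> arrow ij * arrow kl = arrow kl * arrow ij.
Proof.
move=> u; rewrite !inj_pieceM; apply: inj_piece_eq.
by rewrite -!pa_classM; apply/pa_class_rel/Aw_far.
Qed.

Lemma arrow_TC {i j k : 'I_n} (ij : i != j) (ik : i != k) : j != k ->
  arrow ij * arrow ik = arrow ik * arrow ij.
Proof.
move=> jk; rewrite !inj_pieceM; apply: inj_piece_eq.
rewrite -!pa_classM; apply/pa_class_rel/Aw_TC.
by rewrite /= !inE negb_or ij ik jk.
Qed.

Lemma arrow_4T {i j k : 'I_n} (ij : i != j) (ik : i != k) (jk : j != k) :
  (arrow ij + arrow ik) * arrow jk = arrow jk * (arrow ij + arrow ik).
Proof.
rewrite !inj_pieceD !inj_pieceM; apply: inj_piece_eq.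
by rewrite -!pa_classD -!pa_classM; apply/pa_class_rel/Aw_4T.
Qed.

(** The images under [t] are named [k] and [l], so that the target arrow can be a given one such as
    an adjacent arrow. *)
Lemma arrow_act {i j k l : 'I_n} (ij : i != j) (kl : k != l) (t : {perm 'I_n}) :
  t i = k -> t j = l -> arrow ij * permA t = permA t * arrow kl.
Proof.
move=> ek el; subst k l; rewrite !inj_pieceM; apply: inj_piece_eq.
by rewrite -!pa_classM; apply/pa_class_rel/Aw_act.
Qed.

Lemma comp_arrow0 {i j : 'I_n} (ij : i != j) : comp (arrow ij) 0 = 0.
Proof. by rewrite comp_inj. Qed.

Lemma arrow_eq {i j k l : 'I_n} (ij : i != j) (kl : k != l) :
  i = k -> j = l -> arrow ij = arrow kl.
Proof.
by move=> ei ej; subst k l; apply: inj_piece_eq; rewrite (bool_irrelevance ij kl).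
Qed.

Lemma permA_cexp {i j k l : 'I_n} (ij : i != j) (kl : k != l) (t : {perm 'I_n}) :
  t i = k -> t j = l -> permA t * cexp (arrow kl) = cexp (arrow ij) * permA t.
Proof.
move=> ei ej; apply: cexp_intertwine; try exact: comp_arrow0.
exact/esym/arrow_act.
Qed.

Lemma cexpN_permA {i j k l : 'I_n} (ij : i != j) (kl : k != l) (t : {perm 'I_n}) :
  t i = k -> t j = l ->
  cexp (- arrow ij) * permA t = permA t * cexp (- arrow kl).
Proof.
move=> ei ej; apply/esym/cexp_intertwine; rewrite ?compN ?comp_arrow0 ?oppr0 //.
by rewrite mulrN mulNr (arrow_act _ kl).
Qed.

Lemma permA_tperm2 (i j : 'I_n) : permA (tperm i j) * permA (tperm i j) = 1 :> Aw n.
Proof. by rewrite -permAM tperm2 permA1. Qed.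

(** Each side is a conjugate of one transposition by the other, and both conjugates are
    [tperm p r]. *)
Lemma tperm_braid (p q r : 'I_n) : p != q -> q != r -> p != r ->
  (tperm p q * tperm q r * tperm p q = tperm q r * tperm p q * tperm q r)%g.
Proof.
move=> pq qr pr.
have -> : (tperm p q * tperm q r * tperm p q = tperm q r ^ tperm p q)%g.
  by rewrite conjgE tpermV mulgA.
have -> : (tperm q r * tperm p q * tperm q r = tperm p q ^ tperm q r)%g.
  by rewrite conjgE tpermV mulgA.
by rewrite !tpermJ tpermR tpermL !tpermD // eq_sym.
Qed.

End Relations.

(* [S], [T] stand for the two adjacent transpositions of three strands [p], [q],
   [r], and [x], [y], [z] for the exponentials of the arrows [pq], [pr], [qr]. *)
Section ThreeStrands.
Context {R : nzRingType} {S T x y z : R}.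
Hypotheses (Sz : S * z = y * S) (Sy : S * y = z * S).
Hypotheses (Tx : T * x = y * T) (Ty : T * y = x * T).
Hypothesis braidST : S * T * S = T * S * T.

(** With the permutations pushed right, the sides become [x * y * z * (S * T * S)] and
    [z * y * x * (T * S * T)]. *)
Lemma sigma_braid : x * y * z = z * y * x ->
  (x * S) * (z * T) * (x * S) = (z * T) * (x * S) * (z * T).
Proof.
move=> yb; transitivity (x * y * z * (S * T * S)).
  rewrite !mulrA -[_ * S * z]mulrA Sz !mulrA.
  by rewrite -[_ * T * x]mulrA Tx !mulrA -[_ * S * y]mulrA Sy !mulrA.
rewrite yb braidST !mulrA -[_ * T * x]mulrA Tx !mulrA.
by rewrite -[_ * S * z]mulrA Sz !mulrA -[_ * T * y]mulrA Ty !mulrA.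
Qed.

(** The same pushing leaves [x * y] against [y * x]: the arrow [qr] has been carried to [pr]. *)
Lemma overcrossings_commute : x * y = y * x ->
  (x * S) * (z * T) * S = T * (x * S) * (z * T).
Proof.
move=> xy; transitivity (x * y * (S * T * S)).
  by rewrite !mulrA -[_ * S * z]mulrA Sz !mulrA.
rewrite xy braidST !mulrA Tx -[_ * S * z]mulrA Sz !mulrA.
by rewrite -[_ * T * y]mulrA Ty !mulrA.
Qed.

(** Both sides carry the single exponential to [y], leaving only the braid relation of
    permutations. *)
Lemma sigma_mixed : S * (z * T) * S = T * (x * S) * T.
Proof. by rewrite !mulrA Sz Tx -!mulrA (mulrA S) braidST !mulrA. Qed.

End ThreeStrands.

(** Here [x], [y], [z] stand for exponentials of the negated arrows. An inverse crossing has its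
    permutation in front, so permutations are pushed left and both sides end in [y]. *)
Lemma sigmaV_mixed {R : nzRingType} {S T x y z : R} :
  z * S = S * y -> x * T = T * y -> S * T * S = T * S * T ->
  S * (T * z) * S = T * (S * x) * T.
Proof.
move=> zS xT braidST.
by rewrite -!mulrA zS xT !mulrA braidST.
Qed.

Lemma sigma_far {R : nzRingType} {S T x z : R} :
  S * T = T * S -> x * z = z * x -> S * z = z * S -> T * x = x * T ->
  (x * S) * (z * T) = (z * T) * (x * S).
Proof.
move=> ST xz Sz Tx; rewrite !mulrA -[_ * S * z]mulrA Sz !mulrA xz.
by rewrite -[LHS]mulrA ST !mulrA -[_ * T * x]mulrA Tx !mulrA.
Qed.

Lemma virtual_sigma_far {R : nzRingType} {S T z : R} :
  S * T = T * S -> S * z = z * S -> S * (z * T) = (z * T) * S.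
Proof. by move=> ST Sz; rewrite mulrA Sz -mulrA ST mulrA. Qed.

(** * The letter values respect the relations of the w-braid group *)

Section WordRelations.
Context {n : nat}.

Lemma Zletter_sigma i : Zletter (@crossing n i true) = cexp (adj_arrow i) * adj_tperm i.
Proof. by []. Qed.

Lemma Zletter_sigmaV i : Zletter (@crossing n i false) = adj_tperm i * cexp (- adj_arrow i).
Proof. by []. Qed.

Lemma Zletter_virtual i : Zletter (@virtual n i) = adj_tperm i.
Proof. by []. Qed.

Lemma Zword_cons l w : @Zword n (l :: w) = Zletter l * Zword w.
Proof. by rewrite /Zword big_cons. Qed.

Lemma Zword_nil : @Zword n [::] = 1.
Proof. by rewrite /Zword big_nil. Qed.

Lemma Zword_cat u v : @Zword n (u ++ v) = Zword u * Zword v.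
Proof. by rewrite /Zword big_cat. Qed.

Lemma Zletter_cancel (x : wgen n) b : Zletter (x, b) * Zletter (x, ~~ b) = 1.
Proof.
have a0 i : comp (@adj_arrow n i) 0 = 0 by exact: comp_arrow0.
have s2 i : @adj_tperm n i * adj_tperm i = 1 by exact: permA_tperm2.
case: x b => [i [] | i b]; rewrite [Zletter _]/= [X in _ * X]/=.
- by rewrite mulrA -[_ * _ * adj_tperm i]mulrA s2 mulr1 cexpNr.
(* Applied to the negated arrow, [cexpNr] gives the product in the other order. *)
- have := cexpNr (- adj_arrow i); rewrite compN a0 oppr0 opprK => /(_ erefl) e.
  by rewrite -mulrA (mulrA (cexp _)) e mul1r s2.
- exact: s2.
Qed.

Lemma adj_arrowE {i : 'I_n.-1} {p q : 'I_n} (pq : p != q) :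
  i = p :> nat -> i.+1 = q :> nat -> adj_arrow i = arrow pq.
Proof. by move=> ep eq; apply: arrow_eq; apply: val_inj. Qed.

Lemma adj_tpermE {i : 'I_n.-1} {p q : 'I_n} :
  i = p :> nat -> i.+1 = q :> nat -> adj_tperm i = permA (tperm p q).
Proof.
by move=> ep eq; rewrite /adj_tperm; congr (permA (tperm _ _)); apply: val_inj.
Qed.

(** Collects the hypotheses of the three-strand lemmas. The arrow [pr] joins non-adjacent strands,
    so its exponentials enter only as witnesses. *)
Lemma adjacent_relations {i j : 'I_n.-1} : j = i.+1 :> nat ->
  exists y yN : Aw n,
  let S := adj_tperm i in let T := adj_tperm j in
  let x := cexp (adj_arrow i) in let z := cexp (adj_arrow j) in
  [/\ S * T * S = T * S * T,
      [/\ S * z = y * S, S * y = z * S, T * x = y * T & T * y = x * T],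
      [/\ x * y * z = z * y * x & x * y = y * x] &
      [/\ cexp (- adj_arrow j) * S = S * yN & cexp (- adj_arrow i) * T = T * yN]].
Proof.
move=> ji; pose p := strand i; pose q := strandS i; pose r := strandS j.
have pq : p != q by rewrite -val_eqE /=; lia.
have qr : q != r by rewrite -val_eqE /= ji; lia.
have pr : p != r by rewrite -val_eqE /= ji; lia.
have qp : q != p by rewrite eq_sym.
have rq : r != q by rewrite eq_sym.
have rp : r != p by rewrite eq_sym.
rewrite (adj_arrowE pq erefl erefl) (adj_arrowE qr ji erefl).
rewrite (@adj_tpermE i p q erefl erefl) (@adj_tpermE j q r ji erefl).
exists (cexp (arrow pr)), (cexp (- arrow pr)); split.
- by rewrite -!permAM tperm_braid.
- split.
  + by apply: permA_cexp; [rewrite tpermL|rewrite tpermD].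
  + by apply: permA_cexp; [rewrite tpermR|rewrite tpermD].
  + by apply: permA_cexp; [rewrite tpermD|rewrite tpermR].
  + by apply: permA_cexp; [rewrite tpermD|rewrite tpermL].
- split.
  + by apply: cexp_yang_baxter; [exact: comp_arrow0..|exact: arrow_TC|exact: arrow_4T].
  + by apply: cexp_comm; [exact: comp_arrow0..|exact: arrow_TC].
- split.
  + by apply: cexpN_permA; [rewrite tpermR|rewrite tpermD].
  + by apply: cexpN_permA; [rewrite tpermD|rewrite tpermL].
Qed.

Lemma distant_relations {i j : 'I_n.-1} : distant i j ->
  let S : Aw n := adj_tperm i in let T := adj_tperm j in
  let x := cexp (adj_arrow i) in let z := cexp (adj_arrow j) in
  [/\ S * T = T * S, x * z = z * x, S * z = z * S & T * x = x * T].
Proof.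
move=> dij; pose p := strand i; pose q := strandS i.
pose r := strand j; pose t := strandS j.
have [pr pt qr qt] : [/\ p != r, p != t, q != r & q != t].
  by move: dij; rewrite /distant -!val_eqE /= => h; split; lia.
have [rp tp rq tq] : [/\ r != p, t != p, r != q & t != q].
  by split; rewrite eq_sym.
split.
- rewrite -!permAM; congr permA.
  (* Conjugation by a disjoint transposition fixes a transposition. *)
  by rewrite conjgC tpermJ !tpermD.
- apply: cexp_comm; [exact: comp_arrow0..|apply: arrow_far].
  by rewrite /= !inE !negb_or !strand_neq pr pt qr ?qt.
- by apply: permA_cexp; rewrite tpermD.
- by apply: permA_cexp; rewrite tpermD.
Qed.

Lemma Zword_rel u v : @wB_rel n u v -> Zword u = Zword v.
Proof.
case=> {u v} [i|i j ji|i j dij|i j ji|i j dij|i j b ji|i j dij|i j ji];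
  rewrite !Zword_cons !Zword_nil !mulr1 ?Zletter_virtual ?Zletter_sigma.
- exact: permA_tperm2.
- by have [y [yN [h _ _ _]]] := adjacent_relations ji; rewrite !mulrA.
- by have [h _ _ _] := distant_relations dij.
- have [y [yN [h [Sz Sy Tx Ty] [yb _] _]]] := adjacent_relations ji.
  by rewrite mulrA [RHS]mulrA (sigma_braid Sz Sy Tx Ty h yb).
- have [h xz Sz Tx] := distant_relations dij.
  by rewrite (sigma_far h xz Sz Tx).
- have [y [yN [h [Sz Sy Tx Ty] _ [zS xT]]]] := adjacent_relations ji.
  rewrite mulrA [RHS]mulrA; case: b; rewrite ?Zletter_sigma ?Zletter_sigmaV.
    by rewrite (sigma_mixed Sz Tx h).
  by rewrite (sigmaV_mixed zS xT h).
- have [h _ Sz _] := distant_relations dij.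
  by rewrite (virtual_sigma_far h Sz).
- have [y [yN [h [Sz Sy Tx Ty] [_ xy] _]]] := adjacent_relations ji.
  by rewrite mulrA [RHS]mulrA (overcrossings_commute Sz Tx Ty h xy).
Qed.
End WordRelations.

(** * The map on the w-braid group and the expansion property *)

Section Expansion.
Context {n : nat}.
Local Notation rel := (@wB_rel n).

Lemma Zword_gcong u v : gcong rel u v -> Zword u = Zword v.
Proof.
elim=> {u v} [//|u v _ -> //|u v w _ -> _ -> //|u u' v v' _ eu _ ev|x b|u v].
- by rewrite !Zword_cat eu ev.
- by rewrite !Zword_cons Zword_nil mulr1 Zletter_cancel.
- exact: Zword_rel.
Qed.

(** Independence of the chosen representative comes from [Zword_gcong]. *)
Definition Zmap (x : wB n) : Aw n := Zword (generic_quotient.repr x).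

Lemma Zmap_gclass w : Zmap (gclass rel w) = Zword w.
Proof. by apply/Zword_gcong/gclassP; rewrite gclass_repr. Qed.

Lemma ZmapM (x y : wB n) : Zmap (x * y)%g = Zmap x * Zmap y.
Proof.
by rewrite -[x]gclass_repr -[y]gclass_repr -gclassM !Zmap_gclass Zword_cat.
Qed.

Lemma Zmap1 : Zmap 1%g = 1.
Proof. by rewrite -(gclass1 rel) Zmap_gclass Zword_nil. Qed.

Lemma Zmap_letter l : Zmap (gclass rel [:: l]) = Zletter l.
Proof. by rewrite Zmap_gclass Zword_cons Zword_nil mulr1. Qed.

Lemma wB_sigmaV (i : 'I_n.-1) :
  (wB_sigma i)^-1%g = gclass rel [:: crossing i false].
Proof.
apply: (@mulgI _ (wB_sigma i)); rewrite mulgV -gclassM -gclass1.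
exact/esym/gclassP/gcong_cancel.
Qed.

Lemma adj_tperm_homogeneous (i : 'I_n.-1) : homogeneous 0 (adj_tperm i).
Proof. exact: inj_piece_homogeneous. Qed.

Lemma adj_arrow_homogeneous (i : 'I_n.-1) : homogeneous 1 (adj_arrow i).
Proof. exact: inj_piece_homogeneous. Qed.

Lemma comp_exp_sub1 (f : Aw n) k : comp f 0 = 0 -> (k <= 1)%N ->
  comp (cexp f - 1) k = comp f k.
Proof.
move=> f0; rewrite compD compN comp1; case: k => [|[|//]] _.
  by rewrite comp_cexp0 // subrr f0.
by rewrite comp_cexp1 // subr0.
Qed.

Lemma leading_cexp {f : Aw n} : comp f 0 = 0 -> leading_term 0 1 (cexp f).
Proof.
move=> f0; split; first by have [] := @leading_term1 _ (Aw_grading n).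
by case=> // _; rewrite comp_cexp0 // comp1.
Qed.

Lemma leading_cexp_sub1 {f : Aw n} : homogeneous 1 f -> leading_term 1 f (cexp f - 1).
Proof. by move=> hf; split=> // k le; rewrite comp_exp_sub1 // hf. Qed.

(** The boolean is coerced to the degree, 0 or 1. Semi-virtual letters become [(exp a - 1) * s] and
    [s * (1 - exp (- a))], whose leading terms are [a * s] and [s * a]. *)
Lemma linext_sletter_leading (l : sletter n) :
  leading_term (is_semivirtual l) (sletter_diagram l)
    (linext Zmap (sletter_ga l)).
Proof.
have ls (i : 'I_n.-1) : leading_term 0 (adj_tperm i) (adj_tperm i).
  by split=> //; exact: adj_tperm_homogeneous.
have Zs i : Zmap (@wB_s n i) = adj_tperm i by exact: Zmap_letter.
have Zsg i : Zmap (@wB_sigma n i) = cexp (adj_arrow i) * adj_tperm i.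
  exact: Zmap_letter.
have ZsgV i : Zmap (@wB_sigma n i)^-1%g = adj_tperm i * cexp (- adj_arrow i).
  by rewrite wB_sigmaV Zmap_letter.
have a1 i : homogeneous 1 (@adj_arrow n i) by exact: adj_arrow_homogeneous.
have a0 i : comp (@adj_arrow n i) 0 = 0 by exact: a1.
have Na0 i : comp (- @adj_arrow n i) 0 = 0 by rewrite compN a0 oppr0.
have la i := leading_cexp (a0 i); have lNa i := leading_cexp (Na0 i).
have sub_s i : linext Zmap (ga_of (@wB_sigma n i) - ga_of (wB_s i)) =
    (cexp (adj_arrow i) - 1) * adj_tperm i.
  by rewrite linextD linextN !linext_ga_of Zsg Zs mulrBl mul1r.
have sub_sV i : linext Zmap (ga_of (wB_s i) - ga_of (@wB_sigma n i)^-1%g) =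
    adj_tperm i * - (cexp (- adj_arrow i) - 1).
  by rewrite linextD linextN !linext_ga_of ZsgV Zs opprB mulrBr mulr1.
have laV (i : 'I_n.-1) : leading_term 1 (adj_arrow i) (- (cexp (- adj_arrow i) - 1)).
  split=> [|k le]; first exact: a1.
  by rewrite compN comp_exp_sub1 // compN opprK.
case: l => [i []|i|i []]; rewrite /sletter_ga /sletter_diagram /is_semivirtual.
- rewrite linext_ga_of Zsg -[X in leading_term _ X]mul1r.
  exact: (leading_termM (la i) (ls i)).
- rewrite linext_ga_of ZsgV -[X in leading_term _ X]mulr1.
  exact: (leading_termM (ls i) (lNa i)).
- by rewrite linext_ga_of Zs.
- rewrite sub_s.
  exact: (leading_termM (leading_cexp_sub1 (a1 i)) (ls i)).
- rewrite sub_sV; exact: (leading_termM (ls i) (laV i)).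
Qed.

Lemma singular_leading (B : seq (sletter n)) :
  leading_term (singularity B) (diagram B) (linext Zmap (singular_ga B)).
Proof.
elim: B => [|l B IH]; rewrite /singularity /diagram /singular_ga.
  (* The unit of the group ring is [ga_of 1] by conversion. *)
  by rewrite !big_nil linext_ga_of Zmap1; exact: leading_term1.
rewrite !big_cons (linextM ZmapM).
exact: (leading_termM (linext_sletter_leading l) IH).
Qed.

End Expansion.

Theorem theorem2p15 (n : nat) (hn : (1 <= n)%N) :
  [/\ (forall (x : wgen n) (b : bool), Zletter (x, b) * Zletter (x, ~~ b) = 1),
      (forall u v : gword (wgen n), wB_rel u v -> Zword u = Zword v) &
      exists Z : wB n -> Aw n,
        [/\ (forall w : gword (wgen n), Z (gclass (@wB_rel n) w) = Zword w),
            (forall i : 'I_n.-1,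
               [/\ Z (wB_s i) = adj_tperm i,
                   Z (wB_sigma i) = cexp (adj_arrow i) * adj_tperm i &
                   Z (wB_sigma i)^-1%g = adj_tperm i * cexp (- adj_arrow i)]),
            Z 1%g = 1,
            (forall B1 B2 : wB n, Z (B1 * B2)%g = Z B1 * Z B2) &
            (forall (m : nat) (B : seq (sletter n)), singularity B = m ->
               homogeneous m (diagram B) /\
               exists2 r : Aw n, higher_terms m r &
                 linext Z (singular_ga B) = diagram B + r)]].
Proof.
split; [exact: Zletter_cancel|exact: Zword_rel|exists Zmap].
split; [exact: Zmap_gclass| |exact: Zmap1|exact: ZmapM|].
  move=> i; split; [exact: Zmap_letter|exact: Zmap_letter|].
  by rewrite wB_sigmaV Zmap_letter.
move=> m B <-; have lB := singular_leading B.
by split; [case: lB|exact: leading_term_higher lB].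
Qed.
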